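(* There exists a skew brace $A=(A,\oplus,\odot)$ whose multiplicative group $A_{\odot}$ is left-orderable and whose additive group $A_{\oplus}$ is not left-orderable.
   Context: A skew brace $A=(A,\oplus,\odot)$ is a set with two binary operations $\oplus,\odot$ such that $A_{\oplus}=(A,\oplus)$ (the additive group, not necessarily abelian) and $A_{\odot}=(A,\odot)$ (the multiplicative group) are groups and $a\odot(b\oplus c)=(a\odot b)\ominus a\oplus(a\odot c)$ for all $a,b,c\in A$. Here $\ominus a$ denotes the inverse of $a$ in $A_{\oplus}$, and $x\ominus y$ means $x\oplus(\ominus y)$. A group $G$ is left-orderable if it admits a total order $<$ such that $g<h$ implies $fg<fh$ for all $f,g,h\in G$. *)

(* Defs.v *)
From HB Require Import structures.
From mathcomp Require Import all_boot.

Set Implicit Arguments.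
Unset Strict Implicit.
Unset Printing Implicit Defensive.

Local Open Scope group_scope.

Definition skew_left_distributive (T : Type)
    (add : T -> T -> T) (opp : T -> T) (mul : T -> T -> T) : Prop :=
  forall a b c : T, mul a (add b c) = add (add (mul a b) (opp a)) (mul a c).

(* A [groupType] has a single group law, written multiplicatively and not
   assumed commutative or finite. The two groups of a skew brace are therefore
   two [Group] classes on the same carrier. *)
Record skewBrace := SkewBrace {
  sb_sort : Type;
  sb_add_class : Group.axioms_ sb_sort;
  sb_mul_class : Group.axioms_ sb_sort;
  sb_distr : skew_left_distributive
    (@mul (Group.Pack sb_add_class)) (@inv (Group.Pack sb_add_class))
    (@mul (Group.Pack sb_mul_class))
}.

Definition additive_group (A : skewBrace) : groupType :=
  Group.Pack (sb_add_class A).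

Definition multiplicative_group (A : skewBrace) : groupType :=
  Group.Pack (sb_mul_class A).

(* The order is Prop-valued, so that no decidability is required of it. *)
Definition left_orderable (G : groupType) : Prop :=
  exists lt : G -> G -> Prop,
    [/\ forall x, ~ lt x x,
        forall x y z, lt x y -> lt y z -> lt x z,
        forall x y, [\/ lt x y, x = y | lt y x] &
        forall f g h, lt g h -> lt (f * g) (f * h)].

(* Main.v *)
Require Import Defs.
From HB Require Import structures.
From mathcomp Require Import all_boot all_order all_algebra.
From mathcomp Require Import zify ring.

(** A group [G] with subgroups [H] and [K] such that every element is uniquely
    a product [h k] carries a skew brace: the addition is the law of [G], and
    the product of [h k] with [g] is [h g k]. The distributive law is then
    just cancellation of [k (h k)^-1 h] in the middle of a product of [G], and
    the multiplicative group is [H] times the opposite of [K]. It is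
    left-orderable as soon as [H] and [K] are, whereas [G] itself may well have
    torsion, which no left-orderable group has.

    This happens for the wallpaper group pgg, generated by two glide reflections
    [a] and [b] of the plane with perpendicular axes, say
    [a (x, y) = (x + 1/2, 1/2 - y)] and [b (x, y) = (1/2 - x, y + 1/2)].
    The translations in this group are the [a^i b^j] with [i] and [j] even, and
    the four cosets of the translation lattice are told apart by the parities of
    [i] and [j]; hence every element is uniquely of the form [a^i b^j], and
    [H = <a>], [K = <b>] are infinite cyclic. But [a b] is a rotation by a half
    turn, so [a b] has order 2.

    In the coordinates [(i, j)] of [a^i b^j] the multiplicative group is the
    group of pairs of integers under componentwise addition, ordered
    lexicographically, and the law of pgg follows from the commutation rule
    [b^j a^k = a^((-1)^j k) b^((-1)^k j)]. *)

Set Implicit Arguments.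
Unset Strict Implicit.
Unset Printing Implicit Defensive.

Import Order.TTheory GRing.Theory.
Local Open Scope ring_scope.

Lemma left_orderable_no_involution (G : groupType) (x : G) :
  left_orderable G -> (x * x = 1)%g -> x = 1%g.
Proof.
move=> [lt [lt_irr lt_trans lt_total lt_mul]] xx1.
(* Translating by [x] exchanges [1] and [x], hence would reverse any strict
   inequality between them. *)
case: (lt_total 1%g x) => [lt1x | // | ltx1].
- have := lt_mul x _ _ lt1x; rewrite mulg1 xx1 => ltx1.
  by case: (lt_irr _ (lt_trans _ _ _ lt1x ltx1)).
- have := lt_mul x _ _ ltx1; rewrite mulg1 xx1 => lt1x.
  by case: (lt_irr _ (lt_trans _ _ _ lt1x ltx1)).
Qed.

Definition sgn (n : int) : int := (-1) ^ n.

Lemma sgnD m n : sgn (m + n) = sgn m * sgn n.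
Proof. by rewrite /sgn exprzDr // unitrN1. Qed.

Lemma sgn_pm1 n : sgn n = 1 \/ sgn n = -1.
Proof. by rewrite /sgn expN1r -signr_odd; case: odd; [right | left]. Qed.

Lemma sgnN n : sgn (- n) = sgn n.
Proof. by rewrite /sgn !expN1r abszN. Qed.

Lemma sgnM m n : sgn (sgn m * n) = sgn n.
Proof. by case: (sgn_pm1 m) => ->; rewrite ?mul1r // mulN1r sgnN. Qed.

Section Pgg.

Implicit Types x y z : int * int.

Definition pgg_mul x y : int * int :=
  (x.1 + sgn x.2 * y.1, sgn y.1 * x.2 + y.2).

Definition pgg_inv x : int * int := (sgn x.2 * - x.1, sgn x.1 * - x.2).

Lemma pgg_mulA : associative pgg_mul.
Proof.
move=> x y z; rewrite /pgg_mul /= !sgnD !sgnM.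
by congr (_, _); ring.
Qed.

Lemma pgg_mul1x : left_id (0, 0) pgg_mul.
Proof. by case=> i j; rewrite /pgg_mul /= mul1r mulr0 !add0r. Qed.

Lemma pgg_mulx1 : right_id (0, 0) pgg_mul.
Proof. by case=> i j; rewrite /pgg_mul /= mul1r mulr0 !addr0. Qed.

Lemma pgg_mulVx : left_inverse (0, 0) pgg_inv pgg_mul.
Proof.
move=> x; rewrite /pgg_mul /pgg_inv /= sgnM sgnN; congr (_, _); first by ring.
by case: (sgn_pm1 x.1) => ->; ring.
Qed.

Lemma pgg_mulxV : right_inverse (0, 0) pgg_inv pgg_mul.
Proof.
move=> x; rewrite /pgg_mul /pgg_inv /= sgnM sgnN; congr (_, _); last by ring.
by case: (sgn_pm1 x.2) => ->; ring.
Qed.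

End Pgg.

Definition pgg : Type := (int * int)%type.

HB.instance Definition _ := Choice.on pgg.
HB.instance Definition _ :=
  isGroup.Build pgg pgg_mulA pgg_mul1x pgg_mulx1 pgg_mulVx pgg_mulxV.

Section Factors.

Implicit Types x y z : int * int.

(** This is [h k, g |-> h g k], since [a^i (a^k b^l) b^j = a^(i+k) b^(j+l)]. *)
Definition factor_mul x y : int * int := (x.1 + y.1, x.2 + y.2).

Definition factor_inv x : int * int := (- x.1, - x.2).

Lemma factor_mulA : associative factor_mul.
Proof. by move=> x y z; rewrite /factor_mul /= !addrA. Qed.

Lemma factor_mul1x : left_id (0, 0) factor_mul.
Proof. by case=> i j; rewrite /factor_mul /= !add0r. Qed.

Lemma factor_mulx1 : right_id (0, 0) factor_mul.
Proof. by case=> i j; rewrite /factor_mul /= !addr0. Qed.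

Lemma factor_mulVx : left_inverse (0, 0) factor_inv factor_mul.
Proof. by move=> x; rewrite /factor_mul /= !addNr. Qed.

Lemma factor_mulxV : right_inverse (0, 0) factor_inv factor_mul.
Proof. by move=> x; rewrite /factor_mul /= !addrN. Qed.

End Factors.

Definition factors : Type := (int * int)%type.

HB.instance Definition _ := Choice.on factors.
HB.instance Definition _ :=
  isGroup.Build factors
    factor_mulA factor_mul1x factor_mulx1 factor_mulVx factor_mulxV.

Lemma factors_left_orderable : left_orderable factors.
Proof.
exists (fun x y => x.1 < y.1 \/ x.1 = y.1 /\ x.2 < y.2); split.
- by move=> x; lia.
- by move=> x y z; lia.
- case=> [i j] [k l] /=.
  have [lt_ik | lt_ki | ->] := ltgtP i k.
  + by apply: Or31; left.
  + by apply: Or33; left.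
  have [lt_jl | lt_lj | ->] := ltgtP j l.
  + by apply: Or31; right.
  + by apply: Or33; right.
  + exact: Or32.
- case=> [i j] [k l] [m n]; rewrite /mul /= => lt_gh; lia.
Qed.

Lemma pgg_factor_distr :
  skew_left_distributive pgg_mul pgg_inv factor_mul.
Proof.
move=> a b c; rewrite /pgg_mul /pgg_inv /factor_mul /=.
rewrite !(sgnD, sgnM, sgnN).
by case: (sgn_pm1 a.1) => ->; case: (sgn_pm1 a.2) => ->; congr (_, _); ring.
Qed.

Definition pgg_brace : skewBrace :=
  @SkewBrace (int * int) (Group.class pgg) (Group.class factors)
    pgg_factor_distr.

Theorem mainTheorem3 :
  exists A : skewBrace,
    left_orderable (multiplicative_group A) /\
    ~ left_orderable (additive_group A).
Proof.
exists pgg_brace; split; first exact: factors_left_orderable.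
move=> /(@left_orderable_no_involution pgg).
(* The half turn [a b]. *)
by move=> /(_ (1, 1) erefl).
Qed.
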